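(* Let ${\boldsymbol{a}},{\boldsymbol{b}}\in\mathbb{R}^n_{\ge0}$. If $\mathcal I({\boldsymbol{a}})\subseteq\mathcal I({\boldsymbol{b}})$, then $\operatorname{Tes}_n({\boldsymbol{a}})$ is a deformation of $\operatorname{Tes}_n({\boldsymbol{b}})$. Moreover, if $\mathcal I({\boldsymbol{a}})=\mathcal I({\boldsymbol{b}})$, then $\operatorname{Tes}_n({\boldsymbol{a}})$ is normally equivalent to $\operatorname{Tes}_n({\boldsymbol{b}})$.
   Context: $\mathbb{U}(n)$ is the space of upper triangular $n\times n$ real matrices $\boldsymbol{m}=(m_{i,j})_{1\le i\le j\le n}$; hook sums $\eta_i(\boldsymbol{m})=m_{i,i}+\sum_{i<j\le n}m_{i,j}-\sum_{1\le j<i}m_{j,i}$. For ${\boldsymbol{a}}\in\mathbb{R}^n_{\ge0}$, $\operatorname{Tes}_n({\boldsymbol{a}})=\{\boldsymbol{m}\in\mathbb{U}(n):\eta_i(\boldsymbol{m})=a_i\ \forall i,\ m_{i,j}\ge0\ \forall\,1\le i\le j\le n\}$. For ${\boldsymbol{a}}\in\mathbb{R}^n_{\ge0}$, $\mathcal I({\boldsymbol{a}})=\{i\in\{1,\dots,n-1\}:a_i>0\}$ (the value of $a_n$ plays no role). A polytope $Q$ is a deformation of a polytope $P$ if the normal fan of $P$ refines the normal fan of $Q$; $P$ and $Q$ are normally equivalent if they have the same normal fan. *)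

(* Defs.v *)
From HB Require Import structures.
From mathcomp Require Import all_boot all_order all_algebra.
From mathcomp Require Import all_classical all_reals.

Set Implicit Arguments.
Unset Strict Implicit.
Unset Printing Implicit Defensive.
Import Order.TTheory GRing.Theory Num.Theory.
Local Open Scope classical_set_scope.
Local Open Scope ring_scope.

Section Polytopes.
Context {R : realType} {V : lmodType R}.
Implicit Types P Q F : set V.

Definition polyhedron P :=
  exists (k : nat) (c : 'I_k -> {scalar V}) (b : 'I_k -> R),
    P = [set x | forall i, c i x <= b i].

(* In finite dimension, boundedness in a norm is boundedness of every linear
   functional. *)
Definition linearly_bounded P :=
  forall c : {scalar V}, exists M : R, forall x, P x -> `|c x| <= M.

Definition polytope P := polyhedron P /\ linearly_bounded P.

Definition face P F :=
  exists (c : {scalar V}) (b : R),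
    (forall x, P x -> c x <= b) /\ F = P `&` [set x | c x = b].

Definition normal_cone P F : set {scalar V} :=
  [set c | forall x y, F x -> P y -> c y <= c x].

(* The fan lives in the dual of the ambient space V, so it has a lineality
   space when P is not full-dimensional.  The empty face is excluded: its
   normal cone would be the whole dual. *)
Definition normal_fan P : set (set {scalar V}) :=
  [set C | exists F, [/\ face P F, F !=set0 & C = normal_cone P F]].

Definition fan_refines (S T : set (set {scalar V})) :=
  (forall C, S C -> exists2 D, T D & C `<=` D) /\
  \bigcup_(C in S) C = \bigcup_(D in T) D.

(* [deformation Q P]: Q is a deformation of P. *)
Definition deformation Q P :=
  [/\ polytope Q, polytope P & fan_refines (normal_fan P) (normal_fan Q)].

Definition normally_equivalent P Q :=
  [/\ polytope P, polytope Q & normal_fan P = normal_fan Q].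

End Polytopes.

(* is_trig_mx means lower triangular, hence the transpose. *)
Definition uppertri (R : realType) (n : nat) : {pred 'M[R]_n} :=
  fun m => is_trig_mx m^T.
Arguments uppertri {R n}.

Fact uppertri_submod_closed (R : realType) (n : nat) :
  submod_closed (@uppertri R n).
Proof.
split=> [|a u v /is_trig_mxP Hu /is_trig_mxP Hv]; apply/is_trig_mxP => i j ij.
  by rewrite !mxE.
by move: (Hu i j ij) (Hv i j ij); rewrite !mxE => -> ->; rewrite mulr0 addr0.
Qed.

HB.instance Definition _ (R : realType) (n : nat) :=
  GRing.isSubmodClosed.Build R 'M[R]_n (@uppertri R n)
    (@uppertri_submod_closed R n).

(* The space U(n), with its own R-module structure. *)
Record utmx (R : realType) (n : nat) := UTMx {
  utmx_val :> 'M[R]_n;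
  _ : utmx_val \in uppertri }.

HB.instance Definition _ (R : realType) (n : nat) :=
  [isSub for @utmx_val R n].
HB.instance Definition _ (R : realType) (n : nat) :=
  [Choice of utmx R n by <:].
HB.instance Definition _ (R : realType) (n : nat) :=
  [SubChoice_isSubLmodule of utmx R n by <:].

Section Tesler.
Context {R : realType} {n : nat}.

Definition hook_sum (m : utmx R n) (i : 'I_n) : R :=
  m i i + \sum_(j < n | (i < j)%N) m i j - \sum_(j < n | (j < i)%N) m j i.

Definition Tes (a : 'rV[R]_n) : set (utmx R n) :=
  [set m | (forall i, hook_sum m i = a ord0 i) /\
           (forall i j : 'I_n, (i <= j)%N -> 0 <= m i j)].

(* Indices are 0-based, so i <= n - 1 in 1-based indexing reads i.+1 < n. *)
Definition positive_indices (a : 'rV[R]_n) : set 'I_n :=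
  [set i : 'I_n | (i.+1 < n)%N /\ 0 < a ord0 i].

End Tesler.

(* Main.v *)
Require Import Defs.
From HB Require Import structures.
From mathcomp Require Import all_boot all_order all_algebra.
From mathcomp Require Import all_classical all_reals.
From mathcomp Require Import ring zify.

Set Implicit Arguments.
Unset Strict Implicit.
Unset Printing Implicit Defensive.
Import Order.TTheory GRing.Theory Num.Theory.
Local Open Scope classical_set_scope.
Local Open Scope ring_scope.

(* Points of Tes(a) are flows on the complete acyclic graph with supplies a and
   an extra sink, m_(i,i) being the flow from i to the sink.  For a functional
   c, let V_i be the largest c-weight of a path from i to the sink, and
   s_(i,j) = V_i - V_j - c_(i,j) >= 0 the slacks (V = 0 at the sink).  Then
   c(m) = sum_i a_i V_i - sum_(i<=j) m_(i,j) s_(i,j) on Tes(a), so the face of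
   Tes(a) maximizing c is cut out by m_(i,j) s_(i,j) = 0, whatever a is.  If
   t a <= b with t > 0, then t x plus a tight flow for b - t a lies in the
   c-face of Tes(b) for every x in the c-face of Tes(a); hence every functional
   maximal on the former face is maximal on the latter, i.e. the normal cones
   are nested.  The vertex n has a single outgoing edge, always of slack 0, so
   b_n - t a_n may be negative. *)

(** * Normal fans in terms of exposed faces *)

Section ExposedFaces.
Context {R : realType} {V : lmodType R}.
Implicit Types P Q F : set V.

Definition argmax_face P (c : {scalar V}) : set V :=
  [set x | P x /\ forall y, P y -> c y <= c x].

(** A bound attained on a nonempty face is the maximum of its functional, so the pair [(c, b)]
    defining the face is determined by [c] alone. *)
Lemma normal_fanE P C :
  normal_fan P C <->
  exists2 c : {scalar V}, argmax_face P c !=set0 &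
    C = normal_cone P (argmax_face P c).
Proof.
split=> [[F [[c [b [Pcb FE]]] [x0 Fx0] ->]]|[c [x0 [Px0 x0max]] ->]].
  exists c; last congr (normal_cone P _).
    exists x0; move: Fx0; rewrite FE => -[Px0 /= cx0]; split=> // y Py.
    by rewrite cx0 Pcb.
  move: Fx0; rewrite FE => -[Px0 /= cx0].
  apply/seteqP; split=> x [Px /= cx]; split=> //=.
    by move=> y Py; rewrite cx Pcb.
  by apply/eqP; rewrite eq_le Pcb //= -cx0 cx.
exists (argmax_face P c); split=> //; last by exists x0; split.
exists c, (c x0); split=> //.
apply/seteqP; split=> x [Px /= xmax]; split=> //=.
  by apply/eqP; rewrite eq_le xmax // x0max.
by move=> y Py; rewrite xmax x0max.
Qed.

Lemma polyhedron_fin (T : finType) (c : T -> {scalar V}) (b : T -> R) :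
  polyhedron [set x | forall t, c t x <= b t].
Proof.
exists #|T|, (fun i => c (enum_val i)), (fun i => b (enum_val i)).
apply/seteqP; split=> x /= xle t; first exact: xle.
by have := xle (enum_rank t); rewrite enum_rankK.
Qed.

(* When every functional attains its maximum, both fans cover the whole dual,
   so refinement reduces to nesting of normal cones of faces exposed by the
   same functional. *)
Lemma argmax_fan_refines P Q :
  (forall c, argmax_face P c !=set0) -> (forall c, argmax_face Q c !=set0) ->
  (forall c, normal_cone P (argmax_face P c) `<=`
             normal_cone Q (argmax_face Q c)) ->
  fan_refines (normal_fan P) (normal_fan Q).
Proof.
move=> P0 Q0 PQ; split=> [C /normal_fanE[c _ ->]|].
  by exists (normal_cone Q (argmax_face Q c)) => //; apply/normal_fanE; exists c.
have cover S : (forall c, argmax_face S c !=set0) ->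
    \bigcup_(C in normal_fan S) C = [set: {scalar V}].
  move=> S0; apply/seteqP; split=> // c _.
  exists (normal_cone S (argmax_face S c)); first by apply/normal_fanE; exists c.
  by move=> x y [_ xmax] Sy; exact: xmax.
by rewrite !cover.
Qed.

Lemma argmax_normal_fan_eq P Q :
  (forall c, argmax_face P c !=set0) -> (forall c, argmax_face Q c !=set0) ->
  (forall c, normal_cone P (argmax_face P c) =
             normal_cone Q (argmax_face Q c)) ->
  normal_fan P = normal_fan Q.
Proof.
move=> P0 Q0 PQ; apply/seteqP; split=> C /normal_fanE[c _ ->];
  by apply/normal_fanE; exists c.
Qed.

End ExposedFaces.

(** * Coordinates, hook sums and matrix units as linear data on U(n) *)

Section UpperTriangular.
Context {R : realType} {n : nat}.
Implicit Types (m x y : utmx R n) (i j k l : 'I_n).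

Lemma utmx_combE (t : R) x y i j : (t *: x + y) i j = t * x i j + y i j.
Proof.
by rewrite (_ : utmx_val _ = t *: utmx_val x + utmx_val y) ?mxE //; exact: linearP.
Qed.

Lemma utmx_lower m i j : (j < i)%N -> m i j = 0.
Proof. by move=> ji; have /is_trig_mxP/(_ j i ji) := valP m; rewrite mxE. Qed.

Definition coord i j m : R := m i j.

Fact coord_linear i j : scalar (coord i j).
Proof. by move=> t x y; rewrite /coord utmx_combE. Qed.
HB.instance Definition _ i j :=
  GRing.isLinear.Build R (utmx R n) R *%R (coord i j) (coord_linear i j).

Definition hook i m : R := hook_sum m i.

Fact hook_linear i : scalar (hook i).
Proof.
move=> t x y; rewrite /hook /hook_sum utmx_combE.
under eq_bigr do rewrite utmx_combE.
under [X in _ - X]eq_bigr do rewrite utmx_combE.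
by rewrite !big_split /= -!mulr_sumr; ring.
Qed.
HB.instance Definition _ i :=
  GRing.isLinear.Build R (utmx R n) R *%R (hook i) (hook_linear i).

(** The default 0 is taken only for [j < i], where the matrix unit is not upper triangular. *)
Definition utunit i j : utmx R n := insubd 0 (delta_mx i j).

Lemma utunitE i j i' j' : (i <= j)%N ->
  utunit i j i' j' = ((i' == i) && (j' == j))%:R.
Proof.
move=> ij; rewrite /utunit insubdK ?mxE //.
apply/is_trig_mxP => k l kl; rewrite !mxE.
by case: andP => // -[/eqP lE /eqP kE]; move: kl; rewrite lE kE ltnNge ij.
Qed.

Lemma utmx_sum_unit m :
  m = \sum_(i < n) \sum_(j < n | (i <= j)%N) m i j *: utunit i j.
Proof.
apply/val_inj/matrixP => i j /=; set S := (X in _ = utmx_val X _ _).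
have -> : S i j = \sum_(k < n) \sum_(l < n | (k <= l)%N)
    m k l * ((i == k) && (j == l))%:R.
  rewrite -[LHS]/(coord i j S) linear_sum; apply: eq_bigr => k _.
  rewrite linear_sum; apply: eq_bigr => l kl.
  by rewrite linearZ /= /coord utunitE.
rewrite (bigD1 i) //= [X in _ + X]big1 ?addr0 => [|k ki]; last first.
  by rewrite big1 // => l kl; rewrite eq_sym (negPf ki) mulr0.
have [ij|ji] := leqP i j; last first.
  rewrite utmx_lower // big1 // => l il.
  by case: (j =P l) => [jl|_]; rewrite ?andbF ?mulr0 //; move: il; rewrite -jl leqNgt ji.
rewrite (bigD1 j) //= !eqxx mulr1 big1 ?addr0 // => l /andP[il lj].
by rewrite [j == l]eq_sym (negPf lj) andbF mulr0.
Qed.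

Lemma hook_utunit i j k : (i <= j)%N ->
  hook k (utunit i j) = (k == i)%:R - ((k == j) && (i < j)%N)%:R.
Proof.
move=> ij; rewrite /hook /hook_sum !utunitE //.
under eq_bigr do rewrite utunitE //.
under [X in _ - X]eq_bigr do rewrite utunitE //.
congr (_ - _).
  have [->|ki] := eqVneq k i; last by rewrite add0r big1.
  move: ij; rewrite leq_eqVlt => /predU1P[/val_inj <-|ij].
    by rewrite eqxx big1 ?addr0 // => l; case: eqP => // ->; rewrite ltnn.
  rewrite (bigD1 j) //= eqxx big1 => [|l /andP[_ /negPf->]//].
  by rewrite addr0 /=; case: eqP ij => [->|_ _]; rewrite ?ltnn ?add0r.
have [->|kj] /= := eqVneq k j; last by rewrite big1 // => l _; rewrite andbF.
case: ltnP => [ij'|ji].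
  rewrite (bigD1 i) //= eqxx big1 ?addr0 // => l /andP[_ /negPf->//].
rewrite big1 // => l lj; case: eqP => // li.
by move: lj; rewrite li ltnNge ji.
Qed.

(** The last vertex sends flow only to the sink, and this flow is its supply plus its inflow. *)
Lemma last_diag_ge0 m i : 0 <= hook i m -> (i.+1 = n)%N ->
  (forall j, (j < i)%N -> 0 <= m j i) -> 0 <= m i i.
Proof.
move=> hm iE mge0; move: hm; rewrite /hook /hook_sum.
rewrite [X in _ + X - _]big1 => [|j ij]; last first.
  by have := ltn_ord j; lia.
rewrite addr0 subr_ge0; apply: le_trans.
by apply: sumr_ge0 => j; exact: mge0.
Qed.

End UpperTriangular.

(** * Longest-path potentials and flows along tight edges *)

Section Potential.
Context {R : realType} {n : nat}.
Implicit Types (m : utmx R n) (i j k l : 'I_n) (w : 'I_n -> 'I_n -> R)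
  (V : 'I_n -> R).

(* A matrix entry (i, j) with i < j is an edge from i to j, and (i, i) is an
   edge from i to a sink of potential 0. *)
Definition slack w V i j : R :=
  V i - w i j - (if (i < j)%N then V j else 0).

(** These are the Bellman equations of the longest-path problem: [V i] is the largest weight of a
    path from [i] to the sink. *)
Definition potential w V :=
  (forall i j, (i <= j)%N -> 0 <= slack w V i j) /\
  (forall i, exists2 j : 'I_n, (i <= j)%N & slack w V i j = 0).

Lemma potential_exists w : exists V, potential w V.
Proof.
(* Backward induction: [n <= i + k] selects the last [k] vertices, and edges lead only to later
   vertices or to the sink. *)
suff /(_ n)[V [V0 V1]] (k : nat) : exists V,
    (forall i j, (n <= i + k)%N -> (i <= j)%N -> 0 <= slack w V i j) /\
    (forall i, (n <= i + k)%N -> exists2 j : 'I_n, (i <= j)%N & slack w V i j = 0).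
  exists V; split=> [i j ij|i]; first by apply: V0 ij; exact: leq_addl.
  by apply: V1; exact: leq_addl.
elim: k => [|k [V [V0 V1]]].
  by exists (fun=> 0); split=> [i j|i]; rewrite addn0 leqNgt ltn_ord.
have [nk|kn] := leqP n k.
  exists V; split=> [i j _ ij|i _]; first by apply: V0 ij; lia.
  by apply: V1; lia.
have i0n : (n - k.+1 < n)%N by lia.
pose i0 := Ordinal i0n.
(* [g j] is the largest weight of a path with first edge [(i0, j)]; its maximum becomes the
   potential of [i0]. *)
pose g j := w i0 j + (if (i0 < j)%N then V j else 0).
case: (@Order.TotalTheory.arg_maxP _ _ _ i0 (fun j => i0 <= j)%N g (leqnn i0)).
move=> jm i0jm gmax.
pose V' i := if i == i0 then g jm else V i.
have V'E i : (i0 < i)%N -> V' i = V i.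
  by rewrite /V'; case: eqP => // ->; rewrite ltnn.
have sE i j : (i0 < i)%N -> (i <= j)%N -> slack w V' i j = slack w V i j.
  by move=> i0i ij; rewrite /slack !V'E // (leq_trans i0i).
have sE0 j : slack w V' i0 j = g jm - g j.
  rewrite /slack {1}/V' eqxx /g opprD addrA; congr (_ - _).
  by case: ifP => // i0j; rewrite V'E.
have cases i : (n <= i + k.+1)%N -> i = i0 \/ (i0 < i)%N /\ (n <= i + k)%N.
  move=> nik; have [->|/eqP ii0] := eqVneq i i0; [by left|right].
  have : nat_of_ord i <> (n - k.+1)%N by move=> e; apply: ii0; exact: val_inj.
  by rewrite /=; lia.
exists V'; split=> [i j /cases[->|[i0i nik]] ij|i /cases[->|[i0i nik]]].
- by rewrite sE0 subr_ge0; exact: gmax.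
- by rewrite sE // V0.
- by exists jm => //; rewrite sE0 subrr.
- by have [j ij sij] := V1 i nik; exists j => //; rewrite sE.
Qed.

Lemma potential_last w V i j :
  potential w V -> (i.+1 = n)%N -> (i <= j)%N -> slack w V i j = 0.
Proof.
move=> [_ /(_ i)[j' ij' sij']] iE ij; rewrite -sij'; congr slack.
by apply: val_inj; move: (ltn_ord j) (ltn_ord j') ij ij' => /=; lia.
Qed.

(** Summation by parts: each edge contributes the potential of its source to one hook sum and
    subtracts that of its target in another. *)
Lemma pairing_dual w V m :
  \sum_(i < n) \sum_(j < n | (i <= j)%N) m i j * w i j =
  \sum_(i < n) hook i m * V i -
  \sum_(i < n) \sum_(j < n | (i <= j)%N) m i j * slack w V i j.
Proof.
have hookE i : hook i m * V i = \sum_(j < n | (i <= j)%N) m i j * V i -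
    \sum_(j < n | (j < i)%N) m j i * V i.
  rewrite /hook /hook_sum mulrBl -!mulr_suml [X in _ = X * _ - _](bigD1 i) //=.
  congr ((_ + _) * _ - _); apply: eq_bigl => j.
  by rewrite ltn_neqAle andbC eq_sym.
under [X in _ = X - _]eq_bigr do rewrite hookE.
(* Inflow terms are regrouped by their source, so that all sums run over the edges leaving [i]. *)
rewrite sumrB [X in _ - X - _](exchange_big_dep predT) //= -!sumrB; apply: eq_bigr => i _.
rewrite [X in _ - X - _](_ : _ = \sum_(j < n | (i <= j)%N)
    m i j * (if (i < j)%N then V j else 0)); last first.
  rewrite big_mkcond [RHS]big_mkcond; apply: eq_bigr => j _.
  by case: ltngtP; rewrite ?mulr0.
by rewrite -!sumrB; apply: eq_bigr => j _; rewrite /slack; ring.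
Qed.

(* One unit of supply at k, sent to the sink along edges of zero slack. *)
Lemma tight_unit_flow w V k : potential w V -> exists m : utmx R n,
  [/\ forall i, hook i m = (i == k)%:R,
      forall i j, 0 <= m i j,
      forall i j, (i < k)%N -> m i j = 0
    & forall i j, (i <= j)%N -> m i j * slack w V i j = 0].
Proof.
move=> [_ V1]; have [d] := ubnP (n - k); elim: d k => // d IHd k nkd.
have [j kj skj] := V1 k.
move: (kj); rewrite leq_eqVlt => /predU1P[/val_inj kjE|ltkj].
  exists (utunit k k); rewrite -kjE in skj; split=> [i|i i'|i i' ik|i i' _].
  - by rewrite hook_utunit // ltnn andbF subr0.
  - by rewrite utunitE // ler0n.
  - by rewrite utunitE //; case: eqP ik => // ->; rewrite ltnn.
  - by rewrite utunitE //; case: andP => [[/eqP-> /eqP->]|]; rewrite ?skj ?mulr0 ?mul0r.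
have [|m [hm m_ge0 m0 ms]] := IHd j; first by move: (ltn_ord j); lia.
(* The unit follows the tight edge to [j], then the flow [m] given by induction; the factor 1 fits
   [linearP] and [utmx_combE]. *)
exists (1 *: utunit k j + m); split=> [i|i i'|i i' ik|i i' ii'].
- by rewrite linearP /= mul1r hm hook_utunit // ltkj andbT subrK.
- by rewrite utmx_combE mul1r utunitE // addr_ge0.
- rewrite utmx_combE mul1r utunitE // m0 ?(ltn_trans ik) // addr0.
  by case: eqP ik => // ->; rewrite ltnn.
- rewrite utmx_combE mulrDl ms // addr0 mul1r utunitE //.
  by case: andP => [[/eqP-> /eqP->]|]; rewrite ?skj ?mulr0 ?mul0r.
Qed.

(** Superposition of unit flows. The one starting at the last vertex vanishes on all earlier rows,
    so a negative supply there does no harm to them. *)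
Lemma tight_flow w V (b : 'I_n -> R) : potential w V ->
  (forall i, (i.+1 < n)%N -> 0 <= b i) -> exists m : utmx R n,
  [/\ forall i, hook i m = b i,
      forall i j, (i.+1 < n)%N -> 0 <= m i j
    & forall i j, (i <= j)%N -> m i j * slack w V i j = 0].
Proof.
move=> wV b_ge0.
have [f fP] := choice (fun k => tight_unit_flow k wV).
pose m := \sum_(k < n) b k *: f k; exists m.
have mE i j : m i j = \sum_(k < n) b k * f k i j.
  rewrite -[LHS]/(coord i j m) linear_sum; apply: eq_bigr => k _.
  by rewrite linearZ.
split=> [i|i j i1|i j ij].
- rewrite linear_sum (bigD1 i) //= big1 ?addr0 => [|k ki].
    by rewrite linearZ /=; have [-> _ _ _] := fP i; rewrite eqxx mulr1.
  by rewrite linearZ /=; have [-> _ _ _] := fP k; rewrite eq_sym (negPf ki) mulr0.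
- rewrite mE sumr_ge0 // => k _; have [_ f_ge0 f0 _] := fP k.
  have [ik|ki] := ltnP i k; first by rewrite f0 // mulr0.
  by rewrite mulr_ge0 // b_ge0 // (leq_ltn_trans _ i1).
- rewrite mE mulr_suml big1 // => k _; have [_ _ _ fs] := fP k.
  by rewrite -mulrA fs // mulr0.
Qed.

End Potential.

(** * Faces of Tesler polytopes and nesting of their normal cones *)

Section TeslerFaces.
Context {R : realType} {n : nat}.
Implicit Types (a b : 'rV[R]_n) (x y m : utmx R n) (c : {scalar utmx R n})
  (V : 'I_n -> R).

Definition weight c (i j : 'I_n) : R := c (utunit i j).

Lemma weightE c m :
  c m = \sum_(i < n) \sum_(j < n | (i <= j)%N) m i j * weight c i j.
Proof.
rewrite {1}(utmx_sum_unit m) linear_sum; apply: eq_bigr => i _.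
by rewrite linear_sum; apply: eq_bigr => j _; rewrite linearZ.
Qed.

Lemma Tes_intro a m : (forall i, 0 <= a ord0 i) ->
  (forall i, hook i m = a ord0 i) ->
  (forall i j : 'I_n, (i.+1 < n)%N -> (i <= j)%N -> 0 <= m i j) -> Tes a m.
Proof.
move=> a_ge0 ma m_ge0; split=> // i j ij.
have [i1|i1] := ltnP i.+1 n; first exact: m_ge0.
have iE : (i.+1 = n)%N by apply/eqP; rewrite eqn_leq i1 ltn_ord.
have <- : i = j by apply: val_inj; move: (ltn_ord j) ij => /=; lia.
apply: last_diag_ge0 => [|//|k ki]; first by rewrite ma.
by apply: m_ge0; [move: ki iE; lia|exact: ltnW].
Qed.

(** Weak duality: the slack terms subtracted in [pairing_dual] are nonnegative. *)
Lemma pairing_le a w V m : potential w V -> Tes a m ->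
  \sum_(i < n) \sum_(j < n | (i <= j)%N) m i j * w i j <=
  \sum_(i < n) a ord0 i * V i.
Proof.
move=> [s_ge0 _] [ma m_ge0]; rewrite (pairing_dual w V).
under eq_bigr do rewrite /hook ma.
rewrite gerDl oppr_le0 sumr_ge0 // => i _; rewrite sumr_ge0 // => j ij.
by rewrite mulr_ge0 ?m_ge0 ?s_ge0.
Qed.

(** Complementary slackness: a tight flow with supply [a] attains the dual bound, so at a maximizer
    the nonnegative slack terms sum to 0. *)
Lemma argmax_TesE a c V : (forall i, 0 <= a ord0 i) ->
  potential (weight c) V -> argmax_face (Tes a) c = Tes a `&`
    [set x | forall i j : 'I_n, (i <= j)%N -> x i j * slack (weight c) V i j = 0].
Proof.
move=> a_ge0 cV.
have tight_val x : Tes a x ->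
    (forall i j : 'I_n, (i <= j)%N -> x i j * slack (weight c) V i j = 0) ->
    c x = \sum_(i < n) a ord0 i * V i.
  move=> [xa _] xs; rewrite weightE (pairing_dual _ V) [X in _ - X]big1.
    by rewrite subr0; apply: eq_bigr => i _; rewrite /hook xa.
  by move=> i _; rewrite big1 // => j; exact: xs.
apply/seteqP; split=> x [ax xmax]; split=> //=; last first.
  by move=> y ay; rewrite (tight_val x) // weightE; exact: pairing_le.
have [z [za z_ge0 zs]] := tight_flow (b := a ord0) cV (fun i _ => a_ge0 i).
have az : Tes a z by apply: Tes_intro => // i j i1 _; exact: z_ge0.
have := xmax z az; rewrite (tight_val z) // weightE (pairing_dual _ V).
have [xa x_ge0] := ax; under [X in _ <= X - _]eq_bigr do rewrite /hook xa.
rewrite lerDl oppr_ge0 => sum_le0 i j ij.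
have [s_ge0 _] := cV.
have term_ge0 (k l : 'I_n) : (k <= l)%N -> 0 <= x k l * slack (weight c) V k l.
  by move=> kl; rewrite mulr_ge0 ?x_ge0 ?s_ge0.
have row_ge0 (k : 'I_n) : true ->
    0 <= \sum_(l < n | (k <= l)%N) x k l * slack (weight c) V k l.
  by move=> _; apply: sumr_ge0 => l; exact: term_ge0.
have /eqP : \sum_(k < n) \sum_(l < n | (k <= l)%N)
    x k l * slack (weight c) V k l = 0.
  by apply/eqP; rewrite eq_le sum_le0 sumr_ge0.
rewrite psumr_eq0 // => /allP/(_ i (mem_index_enum i))/=.
rewrite psumr_eq0 => [/allP/(_ j (mem_index_enum j))|l]; last exact: term_ge0.
by rewrite ij => /eqP.
Qed.

Lemma argmax_Tes_neq0 a c : (forall i, 0 <= a ord0 i) ->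
  argmax_face (Tes a) c !=set0.
Proof.
move=> a_ge0; have [V cV] := potential_exists (weight c).
have [z [za z_ge0 zs]] := tight_flow (b := a ord0) cV (fun i _ => a_ge0 i).
exists z; rewrite (argmax_TesE a_ge0 cV); split=> //.
by apply: Tes_intro => // i j i1 _; exact: z_ge0.
Qed.

Lemma Tes_polytope a : polytope (Tes a).
Proof.
split; last first.
  move=> c; have [V cV] := potential_exists (weight c).
  (* A potential for the opposite weights bounds [c] from below. *)
  have [W cW] := potential_exists (fun i j => - weight c i j).
  exists (Num.max (\sum_(i < n) a ord0 i * V i) (\sum_(i < n) a ord0 i * W i)).
  move=> x ax; rewrite ler_norml lerNl !le_max weightE; apply/andP; split.
    apply/orP; right; apply: le_trans (pairing_le cW ax).
    rewrite -sumrN; apply: ler_sum => i _; rewrite -sumrN.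
    by apply: ler_sum => j _; rewrite mulrN.
  by apply/orP; left; exact: pairing_le.
(* Two inequalities per hook equation and one per entry; below the diagonal the latter reads 0 <=
   0. *)
pose T : finType := ('I_n + 'I_n + 'I_n * 'I_n)%type.
pose c (t : T) : {scalar utmx R n} := match t with
  | inl (inl i) => hook i
  | inl (inr i) => \- hook i
  | inr (i, j) => \- coord i j end.
pose b (t : T) : R := match t with
  | inl (inl i) => a ord0 i
  | inl (inr i) => - a ord0 i
  | inr _ => 0 end.
rewrite (_ : Tes a = [set x | forall t, c t x <= b t]); last first.
  apply/seteqP; split=> x.
    move=> [xa x_ge0] [[i|i]|[i j]] /=; rewrite /hook ?xa // oppr_le0 /coord.
    by have [/x_ge0//|/utmx_lower->] := leqP i j.
  move=> xP; split=> [i|i j _].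
    apply/eqP; rewrite eq_le; have /= -> := xP (inl (inl i)).
    by have /= := xP (inl (inr i)); rewrite lerN2.
  by have /= := xP (inr (i, j)); rewrite oppr_le0.
exact: polyhedron_fin.
Qed.

Lemma positive_indices_scale a b : (forall i, 0 <= a ord0 i) -> (forall i, 0 <= b ord0 i) ->
  positive_indices a `<=` positive_indices b ->
  exists2 t : R, 0 < t &
    forall i : 'I_n, (i.+1 < n)%N -> t * a ord0 i <= b ord0 i.
Proof.
move=> a_ge0 b_ge0 ab.
have q_ge0 i : true -> 0 <= a ord0 i / b ord0 i by rewrite divr_ge0.
(* [M] dominates every ratio, and the 1 keeps it positive; a ratio with zero denominator is 0 by
   convention. *)
pose M := 1 + \sum_(i < n) a ord0 i / b ord0 i.
have M0 : 0 < M by rewrite ltr_pwDl // sumr_ge0.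
exists M^-1; rewrite ?invr_gt0 // => i i1; rewrite mulrC ler_pdivrMr //.
have [ai|] := ltP 0 (a ord0 i); last by move=> /le_trans-> //; rewrite mulr_ge0 // ltW.
have [_ bi] : positive_indices b i by exact: ab.
rewrite mulrC -ler_pdivrMr // /M (bigD1 i) //= addrCA lerDl addr_ge0 //.
by apply: sumr_ge0 => j _; exact: q_ge0.
Qed.

Lemma normal_cone_Tes_sub a b c :
  (forall i, 0 <= a ord0 i) -> (forall i, 0 <= b ord0 i) ->
  positive_indices a `<=` positive_indices b ->
  normal_cone (Tes b) (argmax_face (Tes b) c) `<=`
  normal_cone (Tes a) (argmax_face (Tes a) c).
Proof.
move=> a_ge0 b_ge0 ab; have [t t0 tab] := positive_indices_scale a_ge0 b_ge0 ab.
have [V cV] := potential_exists (weight c).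
move=> c' c'b x y; have [W cW] := potential_exists (weight c').
(* It suffices that the face exposed by [c] lies in the face exposed by [c']. *)
suff : argmax_face (Tes a) c x -> argmax_face (Tes a) c' x.
  by move=> xP /xP[_ xmax] ay; exact: xmax.
rewrite (argmax_TesE a_ge0 cV) (argmax_TesE a_ge0 cW) => -[ax /= xs].
split=> //= i j ij.
have [|z [zb z_ge0 zs]] :=
    tight_flow (b := fun k => b ord0 k - t * a ord0 k) cV.
  by move=> k k1; rewrite subr_ge0 tab.
have [xa x_ge0] := ax.
have zx_b : Tes b (t *: x + z).
  apply: Tes_intro => // [k|k l k1 kl]; last first.
    by rewrite utmx_combE addr_ge0 ?z_ge0 // mulr_ge0 ?x_ge0 // ltW.
  by rewrite linearP /= zb {1}/hook xa subrKC.
(* Both summands are tight for [c], so the point lies in the [c]-face of [Tes b], where [c'] is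
   maximal too. *)
have : argmax_face (Tes b) c' (t *: x + z).
  split=> // u bu; apply: c'b => //; rewrite (argmax_TesE b_ge0 cV).
  split=> //= k l kl.
  by rewrite utmx_combE mulrDl zs // -mulrA xs // mulr0 addr0.
rewrite (argmax_TesE b_ge0 cW) => -[_ /(_ i j ij)].
(* In the last row [z] may be negative, but the slack is 0. In earlier rows two nonnegative terms
   with sum 0 both vanish. *)
have [i1|i1] := ltnP i.+1 n; last first.
  move=> _; rewrite (potential_last cW) ?mulr0 //.
  by apply/eqP; rewrite eqn_leq i1 ltn_ord.
have s_ge0 : 0 <= slack (weight c') W i j by case: cW => + _; exact.
rewrite utmx_combE mulrDl => /eqP; rewrite paddr_eq0; last 2 first.
- by rewrite !mulr_ge0 ?x_ge0 // ltW.
- by rewrite mulr_ge0 // z_ge0.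
by rewrite -mulrA mulf_eq0 (gt_eqF t0) /= => /andP[/eqP].
Qed.

End TeslerFaces.

Theorem theorem3p9 (R : realType) (n : nat) (a b : 'rV[R]_n)
    (a_ge0 : forall i, 0 <= a ord0 i) (b_ge0 : forall i, 0 <= b ord0 i) :
  (positive_indices a `<=` positive_indices b -> deformation (Tes a) (Tes b)) /\
  (positive_indices a = positive_indices b ->
     normally_equivalent (Tes a) (Tes b)).
Proof.
have Ta c := argmax_Tes_neq0 c a_ge0; have Tb c := argmax_Tes_neq0 c b_ge0.
split=> ab; split; try exact: Tes_polytope.
  by apply: argmax_fan_refines => // c; exact: normal_cone_Tes_sub.
apply: argmax_normal_fan_eq => // c.
by apply/seteqP; split; apply: normal_cone_Tes_sub => //; rewrite ab.
Qed.
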